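(* Let $m=\dim S$, $a_0=\mathcal A_{E,\mathrm{core}}(p_0)$, and assume that $\mathcal D_{g_0}:T_{p_0}S\to T_{a_0}\mathscr X_{\mathrm{core}}$ is injective. Assume furthermore that the admissible scalar postprocessing class $E$ satisfies the scalar richness hypothesis. Then there exist admissible smooth scalar postprocessings $\psi_1,\dots,\psi_m\in E$ such that the joint observable $$F=\left(\psi_1\circ\mathcal A_{E,\mathrm{core}},\dots,\psi_m\circ\mathcal A_{E,\mathrm{core}}\right):S\to\mathbb R^m$$ has invertible differential at $p_0$. Consequently, after shrinking $S$ around $p_0$, $F$ is a local diffeomorphism onto an open subset of $\mathbb R^m$. In particular, the $m$ scalar observations $\psi_1,\dots,\psi_m$ uniquely determine the parameter point $p$ near $p_0$. If the parameterization $p\mapsto g_p$ is locally injective, they therefore uniquely determine the corresponding Einstein metric within the chosen family.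
   Context: $S$ is a smooth finite-dimensional manifold parameterizing a smooth family $p\mapsto g_p$ of normalized cohomogeneity-one Einstein metrics ($\operatorname{Ric}(g_p)=\lambda g_p$, $\lambda>0$ fixed, invariant under a fixed Lie group action, normalized by a fixed unit-speed normal geodesic) on a compact manifold $M$, with $g_{p_0}=g_0$ the reference metric. Fixed probe data are given: a compact Riemannian target $(N,h)$ with compatible group action, an equivariant homotopy class of maps $M\to N$ with endpoint, smoothness and normalization conditions, and a reference harmonic map $f_0$ for $g_0$. Under normalized Jacobi nondegeneracy (the linearization at $f_0$ of the tension field in the map variable, between the constrained equivariant $C^{k+2,\alpha}$ and $C^{k,\alpha}$ Hölder spaces, $k\ge4$, $0<\alpha<1$, is an isomorphism) and after shrinking $S$ around $p_0$, each $g_p$ has a unique harmonic map $f_p$ near $f_0$, depending smoothly on $p$; $J_p$ denotes the linearization at $f_p$ of the tension field $f\mapsto\tau_{g_p}(f)$, which is invertible, and $G_p=J_p^{-1}$. The (descended) core analytical package is the smooth map $\mathcal A_{E,\mathrm{core}}:S\to\mathscr X_{\mathrm{core}}$, $p\mapsto(J_p,G_p)$, where (after fixed local trivializations) $\mathscr X_{\mathrm{core}}$ is a Banach manifold of operator data. The universal response differential is $\mathcal D_{g_0}:=D_{p_0}\mathcal A_{E,\mathrm{core}}$. Admissible class and scalar richness: write $L=\mathcal D_{g_0}$, $V=T_{p_0}S$. $E$ is a Banach space of admissible smooth scalar postprocessings $\psi:\mathscr X_{\mathrm{core}}\to\mathbb R$ defined near $a_0$. Let $\rho:E\to L(V)^*$,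 $\rho(\psi)=d\psi_{a_0}|_{L(V)}$. $E$ satisfies the scalar richness hypothesis at $g_0$ if $E$ is continuously embedded in the local $C^1$ postprocessing space, $\rho$ is continuous, and $\rho$ is surjective. *)

(* Defs.v *)
From HB Require Import structures.
From mathcomp Require Import all_boot all_order all_algebra.
From mathcomp Require Import all_classical all_reals all_analysis.

Set Implicit Arguments.
Unset Strict Implicit.
Unset Printing Implicit Defensive.

Import Order.TTheory GRing.Theory Num.Theory.
Import numFieldNormedType.Exports.

Local Open Scope classical_set_scope.
Local Open Scope ring_scope.

Section calculus.
Context {R : realType}.

(* [Ck k U f], for [U] open.  One derivative is traded for the map
   [(x, v) |-> 'd f x v] on [U * V].  In finite dimension this is the usual
   C^k; between Banach spaces it lies between Frechet-C^k and Frechet-C^(k-1),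
   so that [smooth] is Frechet-C^oo. *)
Fixpoint Ck (k : nat) (V W : normedModType R) (U : set V) (f : V -> W) : Prop :=
  match k with
  | 0 => forall x, U x -> {for x, continuous f}
  | k'.+1 => (forall x, U x -> differentiable f x) /\
             Ck k' (U `*` [set: V]) (fun z : V * V => 'd f (z.1 : V) z.2)
  end.

Definition smooth (V W : normedModType R) (U : set V) (f : V -> W) : Prop :=
  forall k, Ck k U f.

Definition partial (W : normedModType R) n (i : 'I_n) (f : 'rV[R]_n -> W) :
    'rV[R]_n -> W :=
  fun y => 'D_(delta_mx 0 i) f y.

Definition partials (W : normedModType R) n (s : seq 'I_n) (f : 'rV[R]_n -> W) :
    'rV[R]_n -> W :=
  foldr (@partial W n) f s.

End calculus.

Section bounded_operators.
Context {R : realType} (X Y : normedModType R).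

Definition bounded_operator : {pred X -> Y} :=
  mem [set f : X -> Y | linear f /\ continuous f].

Record blin := Blin { blin_fun :> X -> Y; blinP : blin_fun \in bounded_operator }.

HB.instance Definition _ := [isSub for blin_fun].
HB.instance Definition _ := [Choice of blin by <:].

Lemma bounded_operator_submod_closed : submod_closed bounded_operator.
Proof.
split.
  rewrite inE /=; split; first by move=> a x y /=; rewrite scaler0 addr0.
  exact: cst_continuous.
move=> a f g; rewrite !inE /= => -[lf cf] [lg cg]; split.
  move=> b x y; rewrite -[LHS]/(a *: f _ + g _) lf lg.
  rewrite -[RHS]/(b *: (a *: f x + g x) + (a *: f y + g y)).
  by rewrite !scalerDr !scalerA [a * b]mulrC addrACA.
by move=> x; apply: cvgD; [apply: cvgZl_tmp; exact: cf|exact: cg].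
Qed.

HB.instance Definition _ :=
  GRing.isSubmodClosed.Build R (X -> Y) bounded_operator
    bounded_operator_submod_closed.
HB.instance Definition _ := [SubChoice_isSubLmodule of blin by <:].

Definition opnorm (T : blin) : R := sup [set `|T x| | x in [set x | `|x| <= 1]].

Lemma opnorm_has_sup (T : blin) :
  has_sup [set `|T x| | x in [set x | `|x| <= 1]].
Proof.
split; first by exists `|T 0|, 0 => //=; rewrite normr0.
have /set_mem[lT cT] := blinP T.
pose T' : {linear X -> Y} := HB.pack (T : X -> Y)
  (GRing.isLinear.Build R X Y *:%R (T : X -> Y) lT).
have /linear_boundedP : bounded_near T' (nbhs (0 : X)).
  by apply/linear_bounded_continuous.
move=> /pinfty_ex_gt0[r r0 Tr]; exists r => _ [x /= x1 <-].
by rewrite (le_trans (Tr x))// ler_piMr// ltW.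
Qed.

Lemma opnorm_ge (T : blin) x : `|x| <= 1 -> `|T x| <= opnorm T.
Proof.
move=> x1; apply: sup_upper_bound; first exact: opnorm_has_sup.
by exists x.
Qed.

Lemma opnorm_le (T : blin) c : (forall x, `|x| <= 1 -> `|T x| <= c) ->
  opnorm T <= c.
Proof.
move=> Tc; apply: ge_sup; first exact: (opnorm_has_sup T).1.
by move=> _ [x /= x1 <-]; exact: Tc.
Qed.

Lemma opnormD S T : opnorm (S + T) <= opnorm S + opnorm T.
Proof.
apply: opnorm_le => x x1; rewrite -[X in `|X|]/(S x + T x).
by rewrite (le_trans (ler_normD _ _))// lerD// opnorm_ge.
Qed.

Lemma opnormZ a T : opnorm (a *: T) = `|a| * opnorm T.
Proof.
have le b S : opnorm (b *: S) <= `|b| * opnorm S.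
  apply: opnorm_le => x x1; rewrite -[X in `|X|]/(b *: S x) normrZ.
  by rewrite ler_wpM2l// opnorm_ge.
apply/eqP; rewrite eq_le le /=.
have [->|a0] := eqVneq a 0.
  rewrite normr0 mul0r; apply: le_trans (opnorm_ge (0 *: T) (x := 0) _) => //.
  by rewrite normr0.
rewrite -ler_pdivlMl ?normr_gt0// -normfV (le_trans _ (le _ _))//.
by rewrite scalerA mulVf// scale1r.
Qed.

Lemma opnorm_eq0 T : opnorm T = 0 -> T = 0.
Proof.
move=> T0; apply/val_inj/funext => x; rewrite -[RHS]/(0 : Y).
have /set_mem[lT cT] := blinP T.
pose T' : {linear X -> Y} := HB.pack (T : X -> Y)
  (GRing.isLinear.Build R X Y *:%R (T : X -> Y) lT).
rewrite -[LHS]/(T' x); have [->|x0] := eqVneq x 0; first by rewrite linear0.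
have : `|T' (`|x|^-1 *: x)| <= 0.
  rewrite -[leRHS]T0; apply: opnorm_ge.
  by rewrite normrZ normfV normr_id mulVf// normr_eq0.
rewrite normr_le0 linearZ/= scaler_eq0 invr_eq0 normr_eq0 (negPf x0)/=.
by move/eqP.
Qed.

HB.instance Definition _ :=
  Lmodule_isNormed.Build R blin opnormD opnormZ opnorm_eq0.

End bounded_operators.

Record manifold (R : realType) (n : nat) := Manifold {
  points :> topologicalType;
  chart_ix : Type;
  chart_dom : chart_ix -> set points;
  chart : chart_ix -> points -> 'rV[R]_n;
  chart_inv : chart_ix -> 'rV[R]_n -> points;
  chart_at : points -> chart_ix;
  manifold_hausdorff : hausdorff_space points;
  manifold_second_countable : @second_countable points;
  chart_atP : forall x, chart_dom (chart_at x) x;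
  chart_dom_open : forall i, open (chart_dom i);
  chart_img_open : forall i, open (chart i @` chart_dom i);
  chartK : forall i x, chart_dom i x -> chart_inv i (chart i x) = x;
  chart_continuous : forall i x, chart_dom i x -> {for x, continuous (chart i)};
  chart_inv_continuous : forall i y, (chart i @` chart_dom i) y ->
    {for y, continuous (chart_inv i)};
  chart_transition : forall i j,
    smooth (chart i @` (chart_dom i `&` chart_dom j)) (chart j \o chart_inv i)
}.

Definition chart_img R n (M : manifold R n) (i : chart_ix M) : set 'rV[R]_n :=
  chart i @` chart_dom i.

(* A tangent vector at [x] is the row vector of its coordinates in the
   preferred chart [chart_at x]; linear maps act on row vectors from the right.
   [frame_mx i j x] changes coordinates of T_x M from chart [i] to chart [j]. *)
Definition frame_mx R n (M : manifold R n) (i j : chart_ix M) (x : M) : 'M[R]_n :=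
  'J (chart j \o chart_inv i) (chart i x).

Section maps.
Context {R : realType} {n d : nat} {M : manifold R n} {N : manifold R d}.

Definition map_loc (f : M -> N) (i : chart_ix M) (j : chart_ix N) :
    'rV[R]_n -> 'rV[R]_d :=
  chart j \o f \o chart_inv i.

Definition map_dom (f : M -> N) (i : chart_ix M) (j : chart_ix N) :
    set 'rV[R]_n :=
  chart i @` (chart_dom i `&` f @^-1` chart_dom j).

Definition smooth_map (f : M -> N) : Prop :=
  continuous f /\ forall i j, smooth (map_dom f i j) (map_loc f i j).

Definition tmap (f : M -> N) (x : M) : 'M[R]_(n, d) :=
  'J (map_loc f (chart_at x) (chart_at (f x))) (chart (chart_at x) x).

End maps.

Definition smooth_map2 (R : realType) n1 n2 d (M1 : manifold R n1)
    (M2 : manifold R n2) (N : manifold R d) (f : M1 -> M2 -> N) : Prop :=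
  continuous (fun z : M1 * M2 => f z.1 z.2) /\
  forall i1 i2 j,
    smooth [set z : 'rV[R]_n1 * 'rV[R]_n2 |
             [/\ chart_img i1 z.1, chart_img i2 z.2 &
                 chart_dom j (f (chart_inv i1 z.1) (chart_inv i2 z.2))]]
           (fun z => chart j (f (chart_inv i1 z.1) (chart_inv i2 z.2))).

Section maps_to_normed.
Context {R : realType} {m : nat} {S : manifold R m} {V : normedModType R}.

Definition smooth_to (U : set S) (F : S -> V) : Prop :=
  forall i, smooth (chart i @` (chart_dom i `&` U)) (F \o chart_inv i).

(* The differential of [F] at [p], as a map T_p S = R^m -> V. *)
Definition mdiff (F : S -> V) (p : S) : 'rV[R]_m -> V :=
  'd (F \o chart_inv (chart_at p)) (chart (chart_at p) p).

Definition smooth_from (O : set V) (F : V -> S) : Prop :=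
  (forall y, O y -> {for y, continuous F}) /\
  forall i, smooth (O `&` F @^-1` chart_dom i) (chart i \o F).

End maps_to_normed.

Record local_diffeo_onto_open (R : realType) m (S : manifold R m) (U : set S)
    (F : S -> 'rV[R]_m) : Prop := LocalDiffeo {
  ld_smooth : smooth_to U F;
  ld_open : open (F @` U);
  ld_inv : exists Finv : 'rV[R]_m -> S,
    (forall p, U p -> Finv (F p) = p) /\ smooth_from (F @` U) Finv
}.

Record lie_group (R : realType) (n : nat) := LieGroup {
  lg_manifold :> manifold R n;
  lg_mul : lg_manifold -> lg_manifold -> lg_manifold;
  lg_inv : lg_manifold -> lg_manifold;
  lg_one : lg_manifold;
  lg_mulA : associative lg_mul;
  lg_mul1 : left_id lg_one lg_mul;
  lg_mulV : left_inverse lg_one lg_inv lg_mul;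
  lg_mul_smooth : smooth_map2 lg_mul;
  lg_inv_smooth : smooth_map lg_inv
}.

Record smooth_action (R : realType) l n (K : lie_group R l) (M : manifold R n) :=
  SmoothAction {
  sact :> K -> M -> M;
  sact1 : forall x, sact (lg_one K) x = x;
  sactM : forall a b x, sact (lg_mul a b) x = sact a (sact b x);
  sact_smooth : smooth_map2 sact
}.

(* The rows span the tangent space at [x] of the orbit through [x]. *)
Definition orbit_mx (R : realType) l n (K : lie_group R l) (M : manifold R n)
    (a : smooth_action K M) (x : M) : 'M[R]_(l, n) :=
  tmap (fun b : K => a b x) (lg_one K).

(* The orbits of maximal dimension have codimension one. *)
Definition cohomogeneity_one (R : realType) l n (K : lie_group R l)
    (M : manifold R n) (a : smooth_action K M) : Prop :=
  (forall x, (\rank (orbit_mx a x)).+1 <= n)%N /\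
  (exists x, (\rank (orbit_mx a x)).+1 = n).

(* Coordinate formulas, for a metric with components [G y a b]. *)
Section coordinates.
Context {R : realType} {n : nat}.
Implicit Types (G : 'rV[R]_n -> 'M[R]_n) (y : 'rV[R]_n).

Definition christoffel G y (c a b : 'I_n) : R :=
  2^-1 * \sum_e invmx (G y) c e *
    (partial (W := R^o) a (fun z => G z b e) y
     + partial (W := R^o) b (fun z => G z a e) y
     - partial (W := R^o) e (fun z => G z a b) y).

Definition ricci G y (a b : 'I_n) : R :=
  (\sum_c partial (W := R^o) c (fun z => christoffel G z c a b) y)
  - (\sum_c partial (W := R^o) a (fun z => christoffel G z c c b) y)
  + (\sum_c \sum_e christoffel G y c c e * christoffel G y e a b)
  - (\sum_c \sum_e christoffel G y c a e * christoffel G y e c b).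

End coordinates.

Definition tension_loc (R : realType) n d (G : 'rV[R]_n -> 'M[R]_n)
    (H : 'rV[R]_d -> 'M[R]_d) (u : 'rV[R]_n -> 'rV[R]_d) (y : 'rV[R]_n) :
    'rV[R]_d :=
  let du r a := partial (W := R^o) a (fun z => u z 0 r) in
  \row_r \sum_a \sum_b invmx (G y) a b *
    (partial (W := R^o) a (du r b) y
     - (\sum_c christoffel G y c a b * du r c y)
     + (\sum_s \sum_t christoffel H (u y) r s t * du s a y * du t b y)).

Section metrics.
Context {R : realType} {n : nat} {M : manifold R n}.

(* [g x] is the Gram matrix at [x] in the frame of [chart_at x]. *)
Definition metric_field : Type := M -> 'M[R]_n.

Definition metric_loc (g : metric_field) (i : chart_ix M) (y : 'rV[R]_n) : 'M[R]_n :=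
  let x := chart_inv i y in
  let A := frame_mx i (chart_at x) x in
  A *m g x *m A^T.

Record riemannian (g : metric_field) : Prop := Riemannian {
  riem_sym : forall x, (g x)^T = g x;
  riem_pos : forall x (v : 'rV[R]_n), v != 0 -> 0 < (v *m g x *m v^T) 0 0;
  riem_smooth : forall i, smooth (chart_img i) (metric_loc g i)
}.

Definition einstein (lambda : R) (g : metric_field) : Prop :=
  forall i y, chart_img i y -> forall a b,
    ricci (metric_loc g i) y a b = lambda * metric_loc g i y a b.

Definition invariant_metric l (K : lie_group R l) (a : smooth_action K M)
    (g : metric_field) : Prop :=
  forall (b : K) (x : M),
    tmap (a b) x *m g (a b x) *m (tmap (a b) x)^T = g x.

Definition smooth_metric_family m (S : manifold R m) (g : S -> metric_field) : Prop :=
  forall (s : chart_ix S) (i : chart_ix M),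
    smooth (chart_img s `*` chart_img i)
      (fun z : 'rV[R]_m * 'rV[R]_n => metric_loc (g (chart_inv s z.1)) i z.2).

Definition smooth_curve (I : set R) (c : R -> M) : Prop :=
  (forall t, I t -> {for t, continuous c}) /\
  forall i, smooth (V := R^o) (I `&` c @^-1` chart_dom i) (chart i \o c).

Definition curve_loc (c : R -> M) (t : R) : R -> 'rV[R]_n :=
  chart (chart_at (c t)) \o c.

Definition velocity (c : R -> M) (t : R) : 'rV[R]_n := derive1 (curve_loc c t) t.

Record unit_normal_geodesic l (K : lie_group R l) (a : smooth_action K M)
    (g : metric_field) (I : set R) (c : R -> M) : Prop := UnitNormalGeodesic {
  ung_geodesic : forall t, I t -> forall r,
    derive1n 2 (curve_loc c t) t 0 r +
    \sum_s \sum_q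
      christoffel (metric_loc g (chart_at (c t))) (curve_loc c t t) r s q *
      velocity c t 0 s * velocity c t 0 q = 0;
  ung_unit : forall t, I t -> (velocity c t *m g (c t) *m (velocity c t)^T) 0 0 = 1;
  ung_normal : forall t, I t -> velocity c t *m g (c t) *m (orbit_mx a (c t))^T = 0
}.

Record normalized_einstein_family l (K : lie_group R l) (a : smooth_action K M)
    (lambda : R) (I : set R) (c : R -> M) m (S : manifold R m)
    (g : S -> metric_field) : Prop := NormalizedEinsteinFamily {
  nef_riemannian : forall p, riemannian (g p);
  nef_einstein : forall p, einstein lambda (g p);
  nef_invariant : forall p, invariant_metric a (g p);
  nef_geodesic : forall p, unit_normal_geodesic a (g p) I c;
  nef_smooth : smooth_metric_family g
}.

End metrics.
Arguments metric_field {R n} M.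

Section harmonic.
Context {R : realType} {n d : nat} {M : manifold R n} {N : manifold R d}.

(* [V x] is a tangent vector of [N] at [f x]. *)
Definition field_along (f : M -> N) : Type := M -> 'rV[R]_d.

Definition field_loc (f : M -> N) (V : field_along f) (i : chart_ix M)
    (j : chart_ix N) (y : 'rV[R]_n) : 'rV[R]_d :=
  let x := chart_inv i y in V x *m frame_mx (chart_at (f x)) j (f x).

Definition tension (g : metric_field M) (h : metric_field N) (f : M -> N) :
    field_along f := fun x =>
  tension_loc (metric_loc g (chart_at x)) (metric_loc h (chart_at (f x)))
    (map_loc f (chart_at x) (chart_at (f x))) (chart (chart_at x) x).

Definition harmonic (g : metric_field M) (h : metric_field N) (f : M -> N) : Prop :=
  forall x, tension g h f x = 0.

(* The derivative at [f], in the direction [V], of the tension field, computed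
   in the charts at [x] and [f x].  It does not depend on the charts when [f]
   is harmonic. *)
Definition jacobi (g : metric_field M) (h : metric_field N) (f : M -> N)
    (V : field_along f) : field_along f := fun x =>
  let i := chart_at x in let j := chart_at (f x) in
  derive1 (fun t : R =>
     tension_loc (metric_loc g i) (metric_loc h j)
       (fun y => map_loc f i j y + t *: field_loc V i j y) (chart i x)) 0.

Definition equivariant l (K : lie_group R l) (aM : smooth_action K M)
    (aN : smooth_action K N) (f : M -> N) : Prop :=
  forall b x, f (aM b x) = aN b (f x).

Definition equivariant_field l (K : lie_group R l) (aM : smooth_action K M)
    (aN : smooth_action K N) (f : M -> N) (V : field_along f) : Prop :=
  forall b x, V (aM b x) = V x *m tmap (aN b) (f x).

Definition equivariantly_homotopic l (K : lie_group R l) (aM : smooth_action K M)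
    (aN : smooth_action K N) (f0 f1 : M -> N) : Prop :=
  exists H : R -> M -> N,
    [/\ {within [set z : R * M | 0 <= z.1 <= 1], continuous (fun z => H z.1 z.2)},
        forall t, 0 <= t <= 1 -> equivariant aM aN (H t),
        H 0 = f0 & H 1 = f1].

End harmonic.

(* A finite family of coordinate balls whose interiors cover [M]; Hölder norms
   on a compact [M] are taken with respect to such a family, and are equivalent
   for any two of them. *)
Record ball_cover (R : realType) n (M : manifold R n) := BallCover {
  bc_size : nat;
  bc_chart : 'I_bc_size -> chart_ix M;
  bc_center : 'I_bc_size -> 'rV[R]_n;
  bc_radius : 'I_bc_size -> R;
  bc_radius_gt0 : forall q, 0 < bc_radius q;
  bc_sub : forall q,
    closed_ball (bc_center q) (bc_radius q) `<=` chart_img (bc_chart q);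
  bc_covers : forall x, exists q, chart_dom (bc_chart q) x /\
    ball (bc_center q) (bc_radius q) (chart (bc_chart q) x)
}.

Section holder.
Context {R : realType} {n d : nat} {M : manifold R n} {N : manifold R d}.
Variables (k : nat) (alpha : R).

Section cover.
Variable B : ball_cover M.

Definition bc_ball (q : 'I_(bc_size B)) : set 'rV[R]_n :=
  ball (bc_center q) (bc_radius q).

(* [holder_bound u c]: the C^{k,alpha} norm of the family [u] of functions on
   the balls of [B] is at most [c], up to a factor depending on [n] and [k]. *)
Definition holder_bound (u : 'I_(bc_size B) -> 'rV[R]_n -> 'rV[R]_d) (c : R) : Prop :=
  forall q,
    (forall s : seq 'I_n, (size s <= k)%N -> forall y, bc_ball q y ->
       `|partials s (u q) y| <= c) /\
    (forall s : seq 'I_n, size s = k -> forall y z, bc_ball q y -> bc_ball q z ->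
       `|partials s (u q) y - partials s (u q) z| <= c * `|y - z| `^ alpha).

(* The charts [j] of [N] contain the images under [f] of the closed balls of [B]. *)
Definition adapted (j : 'I_(bc_size B) -> chart_ix N) (f : M -> N) : Prop :=
  forall q y, closed_ball (bc_center q) (bc_radius q) y ->
    chart_dom (j q) (f (chart_inv (bc_chart q) y)).

(* A Banach space [Z] of families of C^{k,alpha} functions on the balls of [B],
   with a norm equivalent to the Hölder norm. *)
Definition holder_space (Z : completeNormedModType R)
    (real : Z -> 'I_(bc_size B) -> 'rV[R]_n -> 'rV[R]_d) : Prop :=
  [/\ forall b z w q y, bc_ball q y ->
        real (b *: z + w) q y = b *: real z q y + real w q y,
      forall z q, Ck k (bc_ball q) (real z q) &
      exists2 C, 0 < C & forall z, holder_bound (real z) (C * `|z|) /\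
        forall c, 0 <= c -> holder_bound (real z) c -> `|z| <= C * c].

Variable j : 'I_(bc_size B) -> chart_ix N.

Definition holder_close (eps : R) (f f' : M -> N) : Prop :=
  adapted j f' /\
  holder_bound (fun q y => map_loc f' (bc_chart q) (j q) y
                           - map_loc f (bc_chart q) (j q) y) eps.

Definition field_balls (f : M -> N) (V : field_along f) (q : 'I_(bc_size B)) :
    'rV[R]_n -> 'rV[R]_d :=
  field_loc V (bc_chart q) (j q).

(* [p |-> f p] is smooth as a map to the Banach manifold of C^{k,alpha} maps:
   in charts it is a smooth map to a Hölder space. *)
Definition smooth_map_family m (S : manifold R m) (f : S -> M -> N) : Prop :=
  exists (Z : completeNormedModType R)
         (real : Z -> 'I_(bc_size B) -> 'rV[R]_n -> 'rV[R]_d) (u : S -> Z),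
    [/\ holder_space real, smooth_to [set: S] u &
        forall p q y, bc_ball q y ->
          map_loc (f p) (bc_chart q) (j q) y = real (u p) q y].

(* [X], through [Phi], is a smooth trivialization over [S] of the bundle of
   Banach spaces [{V | P (f p) V}] of C^{k,alpha} vector fields along [f p]. *)
Record field_trivialization m (S : manifold R m) (f : S -> M -> N)
    (P : forall f : M -> N, field_along f -> Prop) (X : completeNormedModType R)
    (Phi : forall p : S, X -> field_along (f p)) : Prop := FieldTrivialization {
  ft_linear : forall p b xi eta x,
    Phi p (b *: xi + eta) x = b *: Phi p xi x + Phi p eta x;
  ft_image : forall p (V : field_along (f p)), P (f p) V <-> exists xi, Phi p xi = V;
  ft_norm : forall p, exists2 C, 0 < C & forall xi,
    holder_bound (field_balls (Phi p xi)) (C * `|xi|) /\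
    forall c, 0 <= c -> holder_bound (field_balls (Phi p xi)) c -> `|xi| <= C * c;
  ft_smooth : exists (Z : completeNormedModType R)
         (real : Z -> 'I_(bc_size B) -> 'rV[R]_n -> 'rV[R]_d) (T : S -> blin X Z),
    [/\ holder_space real, smooth_to [set: S] T &
        forall p xi q y, bc_ball q y ->
          field_balls (Phi p xi) q y = real (T p xi) q y]
}.

End cover.

Definition holder_map (f : M -> N) : Prop :=
  [/\ continuous f,
      forall i j, Ck k (map_dom f i j) (map_loc f i j) &
      exists (B : ball_cover M) (j : 'I_(bc_size B) -> chart_ix N) (c : R),
        adapted j f /\ holder_bound (fun q => map_loc f (bc_chart q) (j q)) c].

Definition holder_field (f : M -> N) (V : field_along f) : Prop :=
  (forall i j, Ck k (map_dom f i j) (field_loc V i j)) /\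
  exists (B : ball_cover M) (j : 'I_(bc_size B) -> chart_ix N) (c : R),
    adapted j f /\ holder_bound (field_balls j V) c.

End holder.

(* The endpoint, smoothness and normalization conditions of the probe: on maps,
   and, linearized, on the vector fields along a map that make up the domain
   and the codomain of the Jacobi operator. *)
Record probe_conditions (R : realType) n d (M : manifold R n) (N : manifold R d) :=
  ProbeConditions {
  pc_map : (M -> N) -> Prop;
  pc_dom : forall f : M -> N, field_along f -> Prop;
  pc_cod : forall f : M -> N, field_along f -> Prop
}.
Arguments pc_dom {R n d M N} _ _ _.
Arguments pc_cod {R n d M N} _ _ _.

Section probe.
Context {R : realType} {n d l : nat} {M : manifold R n} {N : manifold R d}.
Context {K : lie_group R l}.
Variables (aM : smooth_action K M) (aN : smooth_action K N).
Variables (h : metric_field N) (k : nat) (alpha : R).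

Record probe_map (C : probe_conditions M N) (f0 f : M -> N) : Prop := ProbeMap {
  pm_holder : holder_map k.+2 alpha f;
  pm_equivariant : equivariant aM aN f;
  pm_homotopic : equivariantly_homotopic aM aN f0 f;
  pm_conditions : pc_map C f
}.

Definition constrained_field (r : nat) (P : forall f : M -> N, field_along f -> Prop)
    (f : M -> N) (V : field_along f) : Prop :=
  [/\ holder_field r alpha V, equivariant_field aM aN V & P f V].

Record harmonic_branch (C : probe_conditions M N) (B : ball_cover M)
    (j : 'I_(bc_size B) -> chart_ix N) m (S : manifold R m)
    (g : S -> metric_field M) (p0 : S) (f0 : M -> N) (f : S -> M -> N) : Prop :=
  HarmonicBranch {
  hb_base : f p0 = f0;
  hb_map : forall p, probe_map C f0 (f p);
  hb_harmonic : forall p, harmonic (g p) h (f p);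
  hb_unique : exists2 eps, 0 < eps &
    forall p, holder_close k.+2 alpha j eps f0 (f p) /\
      forall f', probe_map C f0 f' -> harmonic (g p) h f' ->
        holder_close k.+2 alpha j eps f0 f' -> f' = f p;
  hb_smooth : smooth_map_family k.+2 alpha j f
}.

(* The Jacobi operators [J p] and their inverses [G p], read in trivializations
   [PhiX] and [PhiY] of the spaces of constrained equivariant vector fields
   along [f p] of class C^{k+2,alpha} and C^{k,alpha}. *)
Record jacobi_package (C : probe_conditions M N) (B : ball_cover M)
    (j : 'I_(bc_size B) -> chart_ix N) m (S : manifold R m)
    (g : S -> metric_field M) (f : S -> M -> N) (X Y : completeNormedModType R)
    (PhiX : forall p : S, X -> field_along (f p))
    (PhiY : forall p : S, Y -> field_along (f p))
    (J : S -> blin X Y) (G : S -> blin Y X) : Prop := JacobiPackage {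
  jp_dom : field_trivialization k.+2 alpha j (constrained_field k.+2 (pc_dom C)) PhiX;
  jp_cod : field_trivialization k alpha j (constrained_field k (pc_cod C)) PhiY;
  jp_jacobi : forall p xi, PhiY p (J p xi) = jacobi (g p) h (PhiX p xi);
  jp_inverse : forall p, cancel (J p) (G p) /\ cancel (G p) (J p)
}.

End probe.

(* The Banach manifold of operator data is the space of pairs of operators. *)
Definition core_data (R : realType) (X Y : normedModType R) : normedModType R :=
  (blin X Y * blin Y X)%type.

Definition core_package (R : realType) (X Y : normedModType R) m
    (S : manifold R m) (J : S -> blin X Y) (G : S -> blin Y X) :
    S -> core_data X Y :=
  fun p => (J p, G p).

Definition universal_response (R : realType) (X Y : normedModType R) m
    (S : manifold R m) (J : S -> blin X Y) (G : S -> blin Y X) (p0 : S) :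
    'rV[R]_m -> core_data X Y :=
  mdiff (core_package J G) p0.

Record postprocessing_class (R : realType) (XX : normedModType R) (a0 : XX) :=
  PostprocessingClass {
  pp_space :> completeNormedModType R;
  pp_dom : set XX;
  pp_eval : pp_space -> XX -> R^o;
  pp_dom_open : open pp_dom;
  pp_dom_a0 : pp_dom a0;
  pp_eval_linear : forall b psi phi a, pp_dom a ->
    pp_eval (b *: psi + phi) a = b * pp_eval psi a + pp_eval phi a;
  pp_eval_smooth : forall psi, smooth pp_dom (pp_eval psi)
}.

Section richness.
Context {R : realType} {XX : normedModType R} {a0 : XX}.

(* [rho E psi] is to be restricted to the range of the response differential. *)
Definition rho (E : postprocessing_class a0) (psi : E) : XX -> R^o :=
  'd (pp_eval psi) a0.

(* The dual of [range L] consists of the linear functionals on it: [range L]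
   has finite dimension. *)
Record scalar_richness m (L : 'rV[R]_m -> XX) (E : postprocessing_class a0) : Prop :=
  ScalarRichness {
  sr_embedding_inj : forall psi : E,
    (forall a, pp_dom E a -> pp_eval psi a = 0) -> psi = 0;
  sr_embedding_C1 : exists C, forall (psi : E) a, pp_dom E a ->
    `|pp_eval psi a| <= C * `|psi| /\ forall v, `|'d (pp_eval psi) a v| <= C * `|psi| * `|v|;
  sr_rho_continuous : exists C, forall (psi : E) w, range L w ->
    `|rho psi w| <= C * `|psi| * `|w|;
  sr_rho_surjective : forall ell : XX -> R^o,
    (forall b w w', range L w -> range L w' -> ell (b *: w + w') = b * ell w + ell w') ->
    exists psi : E, forall w, range L w -> rho psi w = ell w
}.

Definition joint_observable m (S : manifold R m) (A : S -> XX)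
    (E : postprocessing_class a0) (psi : 'I_m -> E) (p : S) : 'rV[R]_m :=
  \row_r pp_eval (psi r) (A p).

End richness.

Definition locally_injective (S : topologicalType) (T : Type) (g : S -> T) : Prop :=
  forall p, exists2 U : set S, open U /\ U p &
    forall q q', U q -> U q' -> g q = g q' -> q = q'.

(* Main.v *)
Require Import Defs.
From HB Require Import structures.
From mathcomp Require Import all_boot all_order all_algebra.
From mathcomp Require Import ring lra.
From mathcomp Require Import all_classical all_reals all_analysis.

(* The coordinates of V transport along L^-1 : L(V) -> V to functionals on L(V), which
   scalar richness realizes as differentials of postprocessings psi_r.  For these,
   the differential of F at p0 is the identity, and the inverse function theorem applies.  Its
   contraction half is the usual one.  Smoothness of the inverse is obtained from the smoothness
   of (x, w) |-> (dF_x)^-1 w, whose differential is again expressed through this same map. *)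

Set Implicit Arguments.
Unset Strict Implicit.
Unset Printing Implicit Defensive.

Import Order.TTheory GRing.Theory Num.Theory.
Import numFieldNormedType.Exports.

Local Open Scope classical_set_scope.
Local Open Scope ring_scope.

(** * Fréchet differentials, and differentiability of an inverse at a point *)

Section differential.
Context {R : realType}.
Implicit Types V W : normedModType R.

(** [Ck] records a derivative as the map [(x, v) |-> 'd f x v] on pairs, not as a map into a space
    of operators, so smoothness of operator inversion cannot be quoted. It is replaced by the
    fiberwise inverse [Phi] of a family [G] of linear maps. Differentiating G(x, Phi(x, w)) = w
    gives dPhi(x, w)(y, z) = Phi(x, z - dG(x, Phi(x, w))(y, 0)), which involves only [Phi] and the
    derivative of [G]; an induction on the order therefore closes. It starts at continuity, where a
    bound |Phi(x, w)| <= c |w|, uniform in x, stands in for norm continuity of the family. Near a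
    point where the differential is the identity, this bound holds with c = 2. *)

Lemma is_diff_normP V W (f df : V -> W) (x : V) :
  linear df -> continuous df ->
  is_diff x f df <->
  (forall e, 0 < e -> \forall h \near (0 : V),
     `|f (h + x) - f x - df h| <= e * `|h|).
Proof.
move=> ldf cdf.
pose L : {linear V -> W} := HB.pack df (GRing.isLinear.Build _ _ _ _ _ ldf).
have eq_expansion : (f \o shift x = cst (f x) + L +o_ (0 : V) id) <->
    (forall e, 0 < e -> \forall h \near (0 : V),
       `|f (h + x) - f x - df h| <= e * `|h|).
  split=> [/eqaddoP H e e0|H].
    have := H e e0; apply: filterS => h /=; rewrite !fctE /=.
    by rewrite opprD addrA.
  apply/eqaddoP => e e0; have := H e e0; apply: filterS => h /=; rewrite !fctE /=.
  by rewrite opprD addrA.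
split=> [[fx dfE]|/eq_expansion fx].
  by apply/eq_expansion; have := diff_locally fx; rewrite dfE.
have dfE : 'd f x = L :> (V -> W) by exact: diff_unique.
by split => //; apply/diff_locallyP; rewrite dfE; split.
Qed.

Lemma is_diff_linear V W (f : V -> W) (x : V) :
  linear f -> continuous f -> is_diff x f f.
Proof.
move=> lf cf; pose L : {linear V -> W} :=
  HB.pack f (GRing.isLinear.Build _ _ _ _ _ lf).
split; first exact: (@linear_differentiable _ _ _ L).
exact: (@diff_lin _ _ _ L).
Qed.

Lemma near_eq_is_diff V W (f g df : V -> W) (x : V) :
  (\forall y \near x, f y = g y) -> is_diff x f df -> is_diff x g df.
Proof.
move=> fg fx; have gdE := @diff_val _ _ _ _ _ _ _ fx.
have ldf : linear df by rewrite -gdE; exact: linearP.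
have cdf : continuous df by rewrite -gdE; apply: diff_continuous; exact: ex_diff.
apply/is_diff_normP => // e e0.
have /is_diff_normP -/(_ ldf cdf e e0) H := fx.
have fgx := nbhs_singleton fg.
have fg0 : \forall h \near (0 : V), f (h + x) = g (h + x).
  by move: fg; rewrite (near_shift 0 x) subr0.
near=> h; rewrite -fgx -(_ : f (h + x) = g (h + x)); last by near: h.
by near: h.
Unshelve. all: by end_near. Qed.

Lemma near_eq_diff V W (f g : V -> W) (x : V) :
  (\forall y \near x, f y = g y) -> differentiable f x ->
  differentiable g x /\ 'd g x = 'd f x :> (V -> W).
Proof. by move=> fg /differentiableP/(near_eq_is_diff fg)[]. Qed.

(** Mere continuity of [fi] at [f x] suffices: it makes the increment of [fi] small, and the
    expansion of [f] then upgrades this to a linear bound. *)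
Lemma is_diff_inverse V W (f df : V -> W) (fi Phi : W -> V) (x : V) :
  is_diff x f df -> linear Phi -> continuous Phi -> cancel df Phi -> cancel Phi df ->
  {for f x, continuous fi} -> fi (f x) = x ->
  (\forall z \near f x, f (fi z) = z) ->
  is_diff (f x) fi Phi.
Proof.
move=> fx lP cP dfK PhiK ficont fiK fK; have dE := @diff_val _ _ _ _ _ _ _ fx.
have ldf : linear df by rewrite -dE; exact: linearP.
have cdf : continuous df by rewrite -dE; apply: diff_continuous; exact: ex_diff.
have H := (is_diff_normP f x ldf cdf).1 fx.
pose PL : {linear W -> V} := HB.pack Phi (GRing.isLinear.Build _ _ _ _ _ lP).
have [c c0 Pc] := @linear_lipschitz _ _ _ PL cP.
have {}Pc w : `|Phi w| <= c * `|w| := Pc w.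
have PhiB a b : Phi (a - b) = Phi a - Phi b := linearB PL a b.
apply/is_diff_normP => // e e0.
have c20 : 0 < (2 * c)^-1 by rewrite invr_gt0 mulr_gt0.
(* The first entry lets half of |h| absorb the error, whence |h| <= 2 c |k|; with the second, the
   final error is at most c (e / (2 c^2)) (2 c |k|) = e |k|. *)
have e'0 : 0 < Num.min (2 * c)^-1 (e / (2 * c ^+ 2)).
  by rewrite lt_min c20 divr_gt0// mulr_gt0// exprn_gt0.
have fi0 : (fun k => fi (k + f x) - x) @ (0 : W) --> (0 : V).
  have shiftf : (fun k => k + f x) @ (0 : W) --> f x.
    have : (fun k => k + f x) @ (0 : W) --> 0 + f x.
      by apply: cvgD; [exact: cvg_id|exact: cvg_cst].
    by rewrite add0r.
  have : (fun k => fi (k + f x) - x) @ (0 : W) --> fi (f x) - x.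
    by apply: cvgB; [exact: cvg_comp shiftf ficont|exact: cvg_cst].
  by rewrite fiK subrr.
have := fi0 _ (H _ e'0); rewrite nbhs_filterE => H'.
have fK0 : \forall k \near (0 : W), f (fi (k + f x)) = k + f x.
  by move: fK; rewrite (near_shift 0 (f x)) subr0.
near=> k.
have : `|f (fi (k + f x) - x + x) - f x - df (fi (k + f x) - x)| <=
    Num.min (2 * c)^-1 (e / (2 * c ^+ 2)) * `|fi (k + f x) - x|.
  by near: k.
rewrite subrK (_ : f (fi (k + f x)) = k + f x); last by near: k.
rewrite addrK fiK; set h := fi (k + f x) - x => kh.
(* Since [|k - df h| <= |h| / (2 c)], this gives [|h| <= 2 c |k|], so that the
   error [k - df h], which is [o(h)], is [o(k)]. *)
have hPk : `|h - Phi k| <= c * `|k - df h|.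
  by rewrite -normrN opprB -{1}(dfK h) -PhiB Pc.
have hk : `|h| <= 2 * c * `|k|.
  have : `|h| <= c * `|k| + 2^-1 * `|h|.
    rewrite -{1}(subrK (Phi k) h) addrC (le_trans (ler_normD _ _))// lerD//.
    rewrite (le_trans hPk)// (@le_trans _ _ (c * ((2 * c)^-1 * `|h|)))//.
      rewrite ler_pM2l// (le_trans kh)// ler_wpM2r// ge_min lexx//.
    by rewrite invfM mulrA mulrCA mulfV ?mulr1// gt_eqF.
  have -> : 2 * c * `|k| = 2 * (c * `|k|) by rewrite mulrA.
  lra.
rewrite (le_trans hPk)//.
apply: (@le_trans _ _ (c * (e / (2 * c ^+ 2) * (2 * c * `|k|)))).
  rewrite ler_pM2l// (le_trans kh)// ler_pM//.
    by rewrite ltW.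
  by rewrite ge_min lexx orbT.
rewrite le_eqVlt; apply/orP; left; apply/eqP; field.
by rewrite gt_eqF.
Unshelve. all: by end_near. Qed.

End differential.

(** * Calculus of [Ck] maps *)

Section Ck_calculus.
Context {R : realType}.
Implicit Types V W Z : normedModType R.

Lemma open_setXT V Z (U : set V) : open U -> open (U `*` [set: Z]).
Proof.
move=> oU; have -> : U `*` [set: Z] = fst @^-1` U.
  by apply/seteqP; split=> z //= [].
by apply: open_comp => // z _; exact: cvg_fst.
Qed.

Lemma open_setI_preimage (T T' : topologicalType) (U : set T) (O : set T')
    (f : T -> T') :
  open U -> (forall x, U x -> {for x, continuous f}) -> open O ->
  open (U `&` f @^-1` O).
Proof.
move=> oU cf oO; rewrite openE => x [Ux Ofx]; apply: filterI.
  exact: open_nbhs_nbhs.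
by apply: (cf _ Ux); exact: open_nbhs_nbhs.
Qed.

Lemma Ck_subset k V W (U U' : set V) (f : V -> W) :
  U' `<=` U -> Ck k U f -> Ck k U' f.
Proof.
elim: k V W U U' f => [|k IH] V W U U' f sU /=; first by move=> cf x /sU/cf.
move=> [df Cdf]; split; first by move=> x /sU/df.
by apply: IH Cdf => z [/= /sU ? _].
Qed.

Lemma Ck_eq k V W (U : set V) (f g : V -> W) :
  open U -> (forall x, U x -> f x = g x) -> Ck k U f -> Ck k U g.
Proof.
elim: k V W U f g => [|k IH] V W U f g oU fg /=.
  move=> cf x Ux; suff : g y @[y --> x] --> f x by rewrite (fg _ Ux).
  apply: cvg_trans (cf x Ux); apply: near_eq_cvg; near=> y; apply: fg.
  by near: y; exact: open_nbhs_nbhs.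
move=> [df Cdf].
have nfg x : U x -> \forall y \near x, f y = g y.
  by move=> Ux; near=> y; apply: fg; near: y; exact: open_nbhs_nbhs.
split=> [x Ux|]; first exact: (near_eq_diff (nfg _ Ux) (df _ Ux)).1.
apply: (IH _ _ _ _ _ _ _ Cdf); first exact: open_setXT.
by move=> z [Uz _]; rewrite (near_eq_diff (nfg _ Uz) (df _ Uz)).2.
Unshelve. all: by end_near. Qed.

Lemma Ck_continuous k V W (U : set V) (f : V -> W) x :
  Ck k U f -> U x -> {for x, continuous f}.
Proof.
case: k => [|k] /=; first by move=> cf /cf.
by move=> [df _] /df; exact: differentiable_continuous.
Qed.

Lemma CkW k V W (U : set V) (f : V -> W) : Ck k.+1 U f -> Ck k U f.
Proof.
elim: k V W U f => [|k IH] V W U f Cf.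
  by move=> x; exact: Ck_continuous Cf.
by case: Cf => df Cdf; split => //; exact: IH.
Qed.

Lemma Ck_linear k V W (U : set V) (f : V -> W) :
  open U -> linear f -> continuous f -> Ck k U f.
Proof.
elim: k V W U f => [|k IH] V W U f oU lf cf; first by move=> x _; exact: cf.
split=> [x _|]; first exact: (ex_diff (is_diff_def := is_diff_linear x lf cf)).
apply: (@Ck_eq _ _ _ _ (f \o snd)); first exact: open_setXT.
  by move=> z _ /=; rewrite (diff_val (is_diff_def := is_diff_linear z.1 lf cf)).
apply: IH; first exact: open_setXT.
  by move=> a x y /=; rewrite lf.
by move=> z; apply: continuous_comp; [exact: cvg_snd|exact: cf].
Qed.

Lemma Ck_pair k V W Z (U : set V) (f : V -> W) (g : V -> Z) :
  open U -> Ck k U f -> Ck k U g -> Ck k U (fun x => (f x, g x)).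
Proof.
elim: k V W Z U f g => [|k IH] V W Z U f g oU /=.
  by move=> cf cg x Ux; apply: cvg_pair; [exact: cf|exact: cg].
move=> [df Cdf] [dg Cdg]; split=> [x Ux|].
  by apply: differentiable_pair; [exact: df|exact: dg].
apply: (@Ck_eq _ _ _ _ (fun z => ('d f (z.1 : V) z.2, 'd g (z.1 : V) z.2))).
- exact: open_setXT.
- by move=> z [Uz _]; rewrite diff_pair//; [exact: df|exact: dg].
- by apply: IH => //; exact: open_setXT.
Qed.

(** On pairs, the chain rule is itself a composition: the derivative of [g] after the tangent map
    [(x, v) |-> (f x, 'd f x v)]. The induction runs over all spaces at once, and the tangent map
    has order k because [f] has order k+1. *)
Lemma Ck_comp k V W Z (U : set V) (O : set W) (f : V -> W) (g : W -> Z) :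
  open U -> open O -> (forall x, U x -> O (f x)) ->
  Ck k U f -> Ck k O g -> Ck k U (g \o f).
Proof.
elim: k V W Z U O f g => [|k IH] V W Z U O f g oU oO UO /=.
  by move=> cf cg x Ux; apply: continuous_comp; [exact: cf|apply/cg/UO].
move=> Cf Cg; have [df Cdf] := Cf; have [dg Cdg] := Cg; split=> [x Ux|].
  by apply: differentiable_comp; [exact: df|apply/dg/UO].
apply: (@Ck_eq _ _ _ _ ((fun w : W * W => 'd g (w.1 : W) w.2) \o
    (fun z : V * V => (f z.1, 'd f (z.1 : V) z.2)))); first exact: open_setXT.
  by move=> z [Uz _]; rewrite diff_comp//; [exact: df|apply/dg/UO].
apply: (IH _ _ _ _ (O `*` setT) _ _ _ _ _ _ Cdg).
- exact: open_setXT.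
- exact: open_setXT.
- by move=> z [/UO Oz _].
apply: Ck_pair Cdf; first exact: open_setXT.
apply: (IH _ _ _ _ U); [exact: open_setXT|by []|by move=> z []| |exact: CkW].
by apply: Ck_linear => [|//|z]; [exact: open_setXT|exact: cvg_fst].
Qed.

Lemma CkD k V W (U : set V) (f g : V -> W) :
  open U -> Ck k U f -> Ck k U g -> Ck k U (fun x => f x + g x).
Proof.
move=> oU Cf Cg; apply: (@Ck_comp _ _ _ _ _ setT _ (fun w : W * W => w.1 + w.2)
  oU openT _ (Ck_pair oU Cf Cg)) => //.
apply: Ck_linear; first exact: openT.
  by move=> a x y /=; rewrite scalerDr addrACA.
by move=> z; apply: cvgD; [exact: cvg_fst|exact: cvg_snd].
Qed.

Lemma CkZ k V W (U : set V) a (f : V -> W) :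
  open U -> Ck k U f -> Ck k U (fun x => a *: f x).
Proof.
move=> oU Cf; apply: (@Ck_comp _ _ _ _ _ setT _ ( *:%R a) oU openT _ Cf) => //.
apply: Ck_linear; first exact: openT.
  by move=> b x y; rewrite scalerDr !scalerA mulrC.
exact: scaler_continuous.
Qed.

Lemma Ck_sum k V W (J : Type) (s : seq J) (U : set V) (f : J -> V -> W) :
  open U -> (forall i, Ck k U (f i)) -> Ck k U (fun x => \sum_(i <- s) f i x).
Proof.
move=> oU Cf; elim: s => [|i s IHs].
  apply: (@Ck_eq _ _ _ _ (fun=> 0)) => //; first by move=> x _; rewrite big_nil.
  by apply: Ck_linear => // [a x y|x]; [rewrite scaler0 addr0|exact: cvg_cst].
apply: (@Ck_eq _ _ _ _ (fun x => f i x + \sum_(j <- s) f j x)) => //.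
  by move=> x _; rewrite big_cons.
exact: CkD.
Qed.

Lemma Ck_row k V n (U : set V) (f : 'I_n -> V -> R^o) :
  open U -> (forall i, Ck k U (f i)) ->
  Ck k U (fun x => \row_i f i x : 'rV[R]_n).
Proof.
move=> oU Cf; apply: (@Ck_eq _ _ _ _
    (fun x => \sum_i f i x *: (delta_mx 0 i : 'rV[R]_n))) => //.
  by move=> x _; rewrite [RHS]row_sum_delta; apply: eq_bigr => i _; rewrite mxE.
apply: Ck_sum => // i.
apply: (@Ck_comp _ V R^o 'rV[R]_n _ setT _
  (fun a : R^o => (a : R) *: (delta_mx 0 i : 'rV[R]_n)) oU openT _ (Cf i)) => //.
apply: Ck_linear; first exact: openT.
  by move=> a x y; rewrite scalerDl scalerA.
exact: scalel_continuous.
Qed.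

End Ck_calculus.

(** * Regularity of the inverse of a family of linear isomorphisms *)

Section fiberwise_inverse.
Context {R : realType}.
Variables (V W Z : normedModType R) (U : set V) (G : V * W -> Z) (Phi : V * Z -> W).
Variable c : R.
Hypotheses (oU : open U) (G_linear : forall x, U x -> linear (fun v => G (x, v))).
Hypothesis GK : forall x, U x -> cancel (fun v => G (x, v)) (fun w => Phi (x, w)).
Hypothesis PhiK : forall x, U x -> cancel (fun w => Phi (x, w)) (fun v => G (x, v)).
Hypothesis Phi_bounded : forall x w, U x -> `|Phi (x, w)| <= c * `|w|.

Lemma fiberwise_inverse_linear x : U x -> linear (fun w => Phi (x, w)).
Proof.
move=> Ux a w w'; apply: (can_inj (GK Ux)).
by rewrite PhiK// (G_linear Ux a (Phi (x, w))) !PhiK.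
Qed.

(** With v0 = Phi(x0, w0), linearity gives Phi(x, w) - v0 = Phi(x, w - G(x, v0)), of norm at most c
    |w - G(x, v0)|. This tends to 0 by continuity of [G] along the fixed vector v0. *)
Lemma fiberwise_inverse_continuous : Ck 0 (U `*` [set: W]) G ->
  Ck 0 (U `*` [set: Z]) Phi.
Proof.
move=> cG [x0 w0] [/= Ux0 _]; set v0 := Phi (x0, w0).
have Gv0 : (fun z : V * Z => c * `|z.2 - G (z.1, v0)|) @ (x0, w0) --> (0 : R).
  have : (fun z : V * Z => c * `|z.2 - G (z.1, v0)|) @ (x0, w0) -->
      c * `|w0 - G (x0, v0)|.
    apply: cvgMl_tmp; apply: cvg_norm; apply: cvgB; first exact: cvg_snd.
    apply: (cvg_comp (fun z : V * Z => (z.1, v0)) G); last exact: cG.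
    by apply: cvg_pair; [exact: cvg_fst|exact: cvg_cst].
  by rewrite PhiK// subrr normr0 mulr0.
have near_U : \forall z \near (x0, w0), U (z : V * Z).1.
  by apply: (@cvg_fst _ _ (nbhs x0) (nbhs w0)); exact: open_nbhs_nbhs.
apply/cvgrPdist_le => e e0.
have {}Gv0 : \forall z \near (x0, w0), `|0 - c * `|z.2 - G (z.1, v0)| | <= e.
  by move/cvgrPdist_le : Gv0; exact.
near=> z.
have Uz : U z.1 by near: z.
have : `|0 - c * `|z.2 - G (z.1, v0)| | <= e by near: z.
rewrite sub0r normrN => /(le_trans (ler_norm _)).
apply: le_trans; apply: le_trans (Phi_bounded _ Uz).
pose PL : {linear Z -> W} := HB.pack (fun w => Phi (z.1, w))
  (GRing.isLinear.Build _ _ _ _ _ (fiberwise_inverse_linear Uz)).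
rewrite -[Phi (z.1, _)]/(PL _) linearB /= GK// distrC -surjective_pairing.
exact: lexx.
Unshelve. all: by end_near. Qed.

(** In the fiber direction [G] is linear, hence its own differential. This makes the differential of
    (x, v) |-> (x, G(x, v)) triangular. *)
Lemma diff_fiberwise x v a b : U x ->
  (forall z, (U `*` [set: W]) z -> differentiable G z) ->
  'd G (x, v) (a, b) = 'd G (x, v) (a, 0) + G (x, b).
Proof.
move=> Ux /(_ (x, _) (conj Ux I)) dG.
have slice : is_diff v (fun b => (x, b) : V * W) (fun b => (0, b)).
  have := is_diff_pair (is_diff_cst x v) (is_diff_id v).
  by [].
have dGxb := is_diff_comp slice (differentiableP (dG v)).
have cGx : continuous (fun b => G (x, b)).
  move=> b'; apply: (continuous_comp (f := fun b => (x, b))).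
    by apply: cvg_pair; [exact: cvg_cst|exact: cvg_id].
  exact: differentiable_continuous.
have /= dGxE := @diff_val _ _ _ _ _ _ _ dGxb.
have dGxE' := @diff_val _ _ _ _ _ _ _ (is_diff_linear v (G_linear Ux) cGx).
have <- : 'd G (x, v) (0, b) = G (x, b).
  rewrite -[RHS]/((fun b => G (x, b)) b) -dGxE'.
  by rewrite -[LHS]/(('d G (x, v) \o (fun b => (0, b))) b) -dGxE.
by rewrite -linearD; congr ('d _ _ (_, _)); rewrite ?addr0 ?add0r.
Qed.

(** The map (x, v) |-> (x, G(x, v)) has inverse (x, w) |-> (x, Phi(x, w)), and its triangular
    differential is inverted by [dPhi]. Differentiability of an inverse at a point applies, and the
    second component is the claim. *)
Lemma is_diff_fiberwise_inverse x w : U x -> Ck 1 (U `*` [set: W]) G ->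
  is_diff (x, w) Phi
    (fun z => Phi (x, z.2 - 'd G (x, Phi (x, w)) (z.1, 0))).
Proof.
move=> Ux CG; have cPhi := fiberwise_inverse_continuous (CkW CG).
have dG := CG.1; have dGxv := dG (x, Phi (x, w)) (conj Ux I).
set v := Phi (x, w) in dGxv *.
have lPhi := fiberwise_inverse_linear Ux.
pose dPhi := fun z : V * Z => (z.1, Phi (x, z.2 - 'd G (x, v) (z.1, 0))).
have dG_linear0 (a : R) (y y' : V) : 'd G (x, v) (a *: y + y', 0) =
    a *: 'd G (x, v) (y, 0) + 'd G (x, v) (y', 0).
  have -> : (a *: y + y', 0 : W) = a *: (y, 0) + (y', 0).
    by rewrite -[RHS]/(a *: y + y', a *: 0 + 0) scaler0 addr0.
  exact: linearP.
have dPhi_linear : linear dPhi.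
  move=> a z z'; rewrite /dPhi /= dG_linear0 opprD addrACA -scalerBr.
  by congr pair; rewrite (lPhi a).
have dPhi_continuous : continuous dPhi.
  move=> z; apply: cvg_pair; first exact: cvg_fst.
  apply: (cvg_comp (fun z : V * Z => (x, z.2 - 'd G (x, v) (z.1, 0))) Phi); last first.
    by apply: cPhi.
  apply: cvg_pair; first exact: cvg_cst.
  apply: cvgB; first exact: cvg_snd.
  apply: (cvg_comp (fun z : V * Z => (z.1, 0)) ('d G (x, v))); last first.
    exact: diff_continuous.
  by apply: cvg_pair; [exact: cvg_fst|exact: cvg_cst].
have dH : is_diff (x, v) (fun z : V * W => (z.1, G z))
    (fun z => (z.1, 'd G (x, v) z)).
  apply: is_diff_pair; last exact: differentiableP.
  apply: is_diff_linear => // z; exact: cvg_fst.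
have Gv : G (x, v) = w by exact: PhiK.
have near_U : \forall z \near (x, w), U (z : V * Z).1.
  by apply: (@cvg_fst _ _ (nbhs x) (nbhs w)); exact: open_nbhs_nbhs.
have dHi : is_diff (x, w) (fun z : V * Z => (z.1, Phi z)) dPhi.
  rewrite -Gv.
  apply: (is_diff_inverse dH dPhi_linear dPhi_continuous).
  - move=> [a b]; rewrite /dPhi /= (diff_fiberwise v a b Ux dG) addrAC subrr add0r.
    by rewrite GK.
  - move=> [a b]; rewrite /dPhi /= (diff_fiberwise v a _ Ux dG) PhiK//.
    by rewrite addrC subrK.
  - rewrite Gv; apply: cvg_pair; first exact: cvg_fst.
    by apply: cPhi.
  - by rewrite /= GK.
  - rewrite Gv; near=> z; have Uz : U z.1 by near: z.
    rewrite [RHS]surjective_pairing /=; congr pair.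
    by rewrite [Phi z](congr1 Phi (surjective_pairing z)) PhiK.
have dsnd y : is_diff y (@snd V W) (@snd V W).
  by apply: is_diff_linear => // z; exact: cvg_snd.
exact: (is_diff_comp dHi (dsnd _)).
Unshelve. all: by end_near. Qed.

Lemma Ck_fiberwise_inverse k :
  Ck k (U `*` [set: W]) G -> Ck k (U `*` [set: Z]) Phi.
Proof.
elim: k => [|k IH] CG; first exact: fiberwise_inverse_continuous.
have oUZ : open (U `*` [set: Z]) by exact: open_setXT.
have oUZ2 : open ((U `*` [set: Z]) `*` [set: V * Z]) by exact: open_setXT.
have C1G : Ck 1 (U `*` [set: W]) G.
  by elim: k CG {IH} => // k IH /CkW.
have dPhi z : (U `*` [set: Z]) z -> is_diff z Phi
    (fun u => Phi (z.1, u.2 - 'd G (z.1, Phi z) (u.1, 0))).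
  by case: z => x w [Ux _]; exact: is_diff_fiberwise_inverse.
split=> [z Uz|]; first by have [] := dPhi z Uz.
(* In [u], the first component is the base point and the second the direction. [Phi] occurs twice,
   each time only at order k, as does the derivative of [G]. *)
apply: (@Ck_eq _ _ _ _ _ (Phi \o (fun u : (V * Z) * (V * Z) =>
    (u.1.1, u.2.2 - 'd G (u.1.1, Phi u.1) (u.2.1, 0))))) => //.
  by move=> u [/dPhi du _]; rewrite (diff_val (is_diff_def := du)).
have [_ CdG] := CG; have CPhi := IH (CkW CG).
have Ck_proj (T : normedModType R) (f : (V * Z) * (V * Z) -> T) :
    linear f -> continuous f -> Ck k ((U `*` [set: Z]) `*` [set: V * Z]) f.
  exact: Ck_linear.
have c1 : continuous (fun u : (V * Z) * (V * Z) => u.1).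
  by move=> u; exact: cvg_fst.
have c2 : continuous (fun u : (V * Z) * (V * Z) => u.2).
  by move=> u; exact: cvg_snd.
have c11 : continuous (fun u : (V * Z) * (V * Z) => u.1.1).
  by move=> u; exact: (cvg_comp _ fst (c1 u) cvg_fst).
have c21 : continuous (fun u : (V * Z) * (V * Z) => u.2.1).
  by move=> u; exact: (cvg_comp _ fst (c2 u) cvg_fst).
have c22 : continuous (fun u : (V * Z) * (V * Z) => u.2.2).
  by move=> u; exact: (cvg_comp _ snd (c2 u) cvg_snd).
apply: (Ck_comp _ _ _ _ CPhi) => //; first by move=> u [[]].
apply: Ck_pair => //; first exact: Ck_proj.
apply: CkD => //; first exact: Ck_proj.
apply: (@Ck_eq _ _ _ _ _ (fun u => -1 *: 'd G (u.1.1, Phi u.1) (u.2.1, 0))) => //.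
  by move=> u _; rewrite scaleN1r.
apply: CkZ => //.
apply: (@Ck_comp _ k _ _ _ _ ((U `*` [set: W]) `*` [set: V * W])
  (fun u : (V * Z) * (V * Z) => ((u.1.1, Phi u.1), (u.2.1, 0))) _ _ _ _ _ CdG) => //.
  by apply: open_setXT; exact: open_setXT.
apply: Ck_pair => //; apply: Ck_pair => //; try exact: Ck_proj.
  apply: (Ck_comp _ _ _ _ CPhi) => //; first by move=> u [].
  exact: Ck_proj.
apply: Ck_proj; last by move=> u; exact: cvg_cst.
by move=> a y y'; rewrite scaler0 addr0.
Qed.

End fiberwise_inverse.

(** * The inverse function theorem *)

Section inverse_function.
Context {R : realType}.

(** A bootstrap from continuity: the derivative of [Fi] is (z, w) |-> Phi(Fi z, w), and [Phi] has
    every order, so [Fi] of order k gives [Fi] of order k+1. *)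
Lemma smooth_inverse (V W : normedModType R) (U : set V) (O : set W)
    (F : V -> W) (Fi : W -> V) (Phi : V * W -> V) c :
  open U -> open O -> smooth U F ->
  (forall x, U x -> Fi (F x) = x) ->
  (forall z, O z -> U (Fi z) /\ F (Fi z) = z) ->
  (forall z, O z -> {for z, continuous Fi}) ->
  (forall x, U x -> cancel ('d F x) (fun w => Phi (x, w))) ->
  (forall x, U x -> cancel (fun w => Phi (x, w)) ('d F x)) ->
  (forall x w, U x -> `|Phi (x, w)| <= c * `|w|) ->
  smooth O Fi.
Proof.
move=> oU oO CF FK FiK cFi dFK PhiK Phic.
have dF_linear x : U x -> linear (fun v => 'd F ((x, v).1 : V) (x, v).2).
  by move=> _ a v w /=; rewrite linearP.
have CPhi k : Ck k (U `*` [set: W]) Phi.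
  apply: (@Ck_fiberwise_inverse _ _ _ _ U (fun z : V * V => 'd F (z.1 : V) z.2)
    Phi c) => //.
  exact: (CF k.+1).2.
have dF z : O z -> is_diff z Fi (fun w => Phi (Fi z, w)).
  move=> Oz; have [UFiz Fz] := FiK z Oz.
  have dFz : is_diff (Fi z) F ('d F (Fi z)) by apply/differentiableP/(CF 1).1.
  suff : is_diff (F (Fi z)) Fi (fun w => Phi (Fi z, w)) by rewrite Fz.
  have lPhi : linear (fun w => Phi (Fi z, w)).
    exact: (@fiberwise_inverse_linear _ _ _ _ U (fun z => 'd F (z.1 : V) z.2)).
  apply: (is_diff_inverse dFz lPhi _ (dFK _ UFiz) (PhiK _ UFiz)).
  - move=> w; apply: (cvg_comp (fun w => (Fi z, w)) Phi); last exact: (CPhi 0).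
    by apply: cvg_pair; [exact: cvg_cst|exact: cvg_id].
  - by rewrite Fz; exact: cFi.
  - by rewrite Fz.
  - by rewrite Fz; near=> y; apply: (FiK y _).2; near: y; exact: open_nbhs_nbhs.
elim=> [|k IH]; first exact: cFi.
split=> [z /dF[]//|].
apply: (@Ck_eq _ _ _ _ _ (Phi \o (fun z : W * W => (Fi z.1, z.2)))).
- exact: open_setXT.
- by move=> z [/dF dz _]; rewrite (diff_val (is_diff_def := dz)).
apply: (Ck_comp _ _ _ _ (CPhi k)).
- exact: open_setXT.
- exact: open_setXT.
- by move=> z [/FiK[]].
apply: Ck_pair; first exact: open_setXT.
  apply: (Ck_comp _ _ _ _ IH); [exact: open_setXT|by []|by move=> z []|].
  by apply: Ck_linear => [|//|z]; [exact: open_setXT|exact: cvg_fst].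
by apply: Ck_linear => [|//|z]; [exact: open_setXT|exact: cvg_snd].
Unshelve. all: by end_near. Qed.

Lemma row_norm_le n (v : 'rV[R]_n) c :
  0 <= c -> (`|v| <= c) <-> (forall i, `|v 0 i| <= c).
Proof.
move=> c0; rewrite /Num.Def.normr/= mx_normrE; split=> [vc i|vc].
  exact: le_trans (le_bigmax _ _ (0, i)) vc.
by apply: bigmax_le => // -[i j] _ /=; rewrite (ord1 i); exact: vc.
Qed.

Lemma ball_segment (V : normedModType R) (x0 x y : V) r t :
  ball x0 r x -> ball x0 r y -> 0 <= t <= 1 -> ball x0 r (x + t *: (y - x)).
Proof.
rewrite -ball_normE /= => x0x x0y /andP[t0 t1].
have -> : x0 - (x + t *: (y - x)) = (1 - t) *: (x0 - x) + t *: (x0 - y).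
  rewrite scalerBl scale1r -addrA -scalerN -scalerDr opprB addrA subrK.
  by rewrite opprD addrA -scalerN opprB.
rewrite (le_lt_trans (ler_normD _ _))// !normrZ ger0_norm ?subr_ge0// ger0_norm//.
(* Strictness is drawn below from the term of weight t, so t = 0 is separate. *)
have [->|t_neq0] := eqVneq t 0; first by rewrite subr0 mul1r mul0r addr0.
have t_gt0 : 0 < t by rewrite lt_def t_neq0.
have -> : r = (1 - t) * r + t * r by ring.
by rewrite ler_ltD// ?ltr_pM2l// ler_wpM2l ?subr_ge0// ltW.
Qed.

(** The norm on rows is the maximum norm, so the scalar mean value theorem on the segment, one
    coordinate at a time, loses no constant. *)
Lemma mean_value_ball (V : normedModType R) n (f : V -> 'rV[R]_n) (x0 : V) r c :
  (forall x, ball x0 r x -> differentiable f x) ->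
  (forall x v, ball x0 r x -> `|'d f x v| <= c * `|v|) ->
  forall x y, ball x0 r x -> ball x0 r y -> `|f y - f x| <= c * `|y - x|.
Proof.
move=> df dfc x y Bx By.
have c0 : 0 <= c * `|y - x| by rewrite (le_trans _ (dfc x (y - x) Bx)).
apply/row_norm_le => // i; pose l t := x + t *: (y - x).
have Bl t : 0 <= t <= 1 -> ball x0 r (l t) by exact: ball_segment.
pose phi (t : R) : R := f (l t) 0 i.
have dphi (t : R) : 0 <= t <= 1 -> is_derive t 1 phi ('d f (l t) (y - x) 0 i).
  move=> /Bl Blt.
  have dl : is_diff (t : R^o) (l : R^o -> V) (fun h => 0 + h *: (y - x)).
    exact: (is_diffD (is_diff_cst x (t : R^o)) (is_diff_scalel t (y - x))).
  have dcoord v : is_diff v (fun v : 'rV[R]_n => v 0 i : R^o) (fun v => v 0 i).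
    by apply: is_diff_linear; [move=> a u w; rewrite !mxE|exact: coord_continuous].
  have dfl := is_diff_comp (is_diff_comp dl (differentiableP (df _ Blt))) (dcoord _).
  have dphit : differentiable (phi : R^o -> R^o) t.
    exact: (ex_diff (is_diff_def := dfl)).
  split; first exact/derivable1_diffP.
  have := congr1 (@^~ 1) (diff_val (is_diff_def := dfl)); rewrite deriveE//=.
  by rewrite add0r scale1r.
have [||t t01] := @MVT_segment R phi (fun t => 'd f (l t) (y - x) 0 i) _ _ ler01.
- by move=> t; rewrite in_itv /= => /andP[/ltW t0 /ltW t1]; apply: dphi; rewrite t0.
- apply: derivable_within_continuous => t; rewrite in_itv /= => /dphi dt.
  exact: (ex_derive (is_derive := dt)).
rewrite subr0 mulr1 /phi /l scale1r scale0r addr0 subrKC !mxE => ->.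
by move: i {phi dphi}; apply/row_norm_le => //; apply/dfc/Bl; rewrite in_itv in t01.
Qed.

End inverse_function.

(** Makes row vectors a complete normed module, the setting of the Banach fixed point theorem. *)
HB.instance Definition _ (R : realType) m n :=
  Uniform_isComplete.Build 'M[R]_(m, n) cauchy_cvg.

(** * Linear estimates and contractions in finite dimension *)

Section local_inverse.
Context {R : realType} {n : nat}.

Lemma injective_linear_row (f : 'rV[R]_n -> 'rV[R]_n) :
  linear f -> (forall v, f v = 0 -> v = 0) ->
  cancel f (fun w => w *m invmx (lin1_mx f)) /\
  cancel (fun w => w *m invmx (lin1_mx f)) f.
Proof.
move=> lf f0; pose L : {linear 'rV[R]_n -> 'rV[R]_n} :=
  HB.pack f (GRing.isLinear.Build _ _ _ _ _ lf).
have fE v : f v = v *m lin1_mx f by rewrite (mul_rV_lin1 L).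
have uf : lin1_mx f \in unitmx.
  rewrite -row_free_unit -kermx_eq0; apply/rowV0P => v.
  by rewrite sub_kermx -fE => /eqP/f0.
by split=> v; rewrite !fE ?mulmxKV ?mulmxK.
Qed.

Lemma row_linear_norm (f : 'rV[R]_n -> 'rV[R]_n) e : linear f ->
  (forall i, `|f (delta_mx 0 i)| <= e) -> forall v, `|f v| <= n%:R * e * `|v|.
Proof.
move=> lf fe v; pose L : {linear 'rV[R]_n -> 'rV[R]_n} :=
  HB.pack f (GRing.isLinear.Build _ _ _ _ _ lf).
rewrite {1}(row_sum_delta v) -[f _]/(L _) linear_sum (le_trans (ler_norm_sum _ _ _))//.
have -> : n%:R * e * `|v| = \sum_(i < n) `|v| * e.
  by rewrite sumr_const card_ord -[RHS]mulr_natl; ring.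
apply: ler_sum => i _; rewrite linearZ normrZ ler_pM//.
  by apply: (row_norm_le v (normr_ge0 v)).1.
Qed.

Lemma near_diff (V W : normedModType R) (U : set V) (f : V -> W) (x v : V) w e :
  Ck 1 U f -> U x -> 'd f x v = w -> 0 < e ->
  \forall y \near x, `|'d f (y : V) v - w| <= e.
Proof.
move=> [_ Cdf] Ux <- e0.
have : 'd f (y : V) v @[y --> x] --> 'd f x v.
  apply: (cvg_comp (fun y => (y, v))
    (fun z : V * V => 'd f (z.1 : V) z.2)); last exact: (Cdf (x, v)).
  by apply: cvg_pair; [exact: cvg_id|exact: cvg_cst].
by move=> /cvgrPdist_le /(_ _ e0); apply: filterS => y; rewrite distrC.
Qed.

(** [Ck 1] gives continuity of the differential on each fixed vector; applying it to the finitely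
    many basis vectors yields an operator norm estimate. *)
Lemma near_diff_tangent_id (U : set 'rV[R]_n) (F : 'rV[R]_n -> 'rV[R]_n) y0 :
  open U -> U y0 -> Ck 1 U F -> (forall v, 'd F y0 v = v) ->
  \forall x \near y0, forall v, `|'d F x v - v| <= 2^-1 * `|v|.
Proof.
move=> oU Uy0 CF dF0.
(* Summing over n basis vectors multiplies the error by n, and n / (2 (n + 1)) <= 1/2; the successor
   also covers n = 0. *)
have e0 : 0 < (2 * n.+1%:R)^-1 :> R by rewrite invr_gt0 mulr_gt0.
have : \forall x \near y0, forall i : 'I_n,
    `|'d F x (delta_mx 0 i) - delta_mx 0 i| <= (2 * n.+1%:R)^-1.
  suff H (i : 'I_n) : \forall x \near y0,
      `|'d F x (delta_mx 0 i) - delta_mx 0 i| <= (2 * n.+1%:R)^-1.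
    exact: (@filter_forall _ _ _ (nbhs y0) _ H).
  exact: near_diff CF Uy0 (dF0 _) e0.
apply: filterS => x dFx v.
have lin : linear (fun v => 'd F x v - v).
  by move=> a u w; rewrite linearP scalerBr opprD addrACA.
rewrite (le_trans (row_linear_norm lin dFx v))// ler_wpM2r//.
rewrite invfM mulrCA ger_pMr ?invr_gt0// ler_pdivrMr ?mul1r ?ler_nat//.
Qed.

(* The solutions of [F x = z] are the fixed points of [x |-> z - (F x - x)]. *)
Lemma contraction_solve (F : 'rV[R]_n -> 'rV[R]_n) (x0 z : 'rV[R]_n) s :
  0 < s ->
  (forall x y, closed_ball x0 s x -> closed_ball x0 s y ->
     `|(F y - y) - (F x - x)| <= 2^-1 * `|y - x|) ->
  `|z - F x0| <= 2^-1 * s -> exists2 x, closed_ball x0 s x & F x = z.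
Proof.
move=> s0 Fc zs; pose T x := z - (F x - x).
have B0 : closed_ball x0 s x0 by exact: closed_ballxx.
have Tdist x y : closed_ball x0 s x -> closed_ball x0 s y ->
    `|T x - T y| <= 2^-1 * `|x - y|.
  move=> Bx By; have -> : T x - T y = (F y - y) - (F x - x).
    by rewrite /T; move: (F x - x) (F y - y) => a b; rewrite opprB addrC addrA subrK.
  by rewrite [in leRHS]distrC Fc.
have TB : {homo T : x / closed_ball x0 s x}.
  (* [T] moves x to within s of [x0]: s/2 from the contraction estimate and s/2 from the distance of
     [z] to [F x0]. *)
  move=> x Bx; rewrite closed_ballE// /closed_ball_ /=.
  have -> : x0 - T x = (F x - x - (F x0 - x0)) - (z - F x0).
    rewrite /T; move: (F x - x) => a; rewrite !opprB -addrA.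
    by rewrite [x0 - _ + _]addrA subrK addrCA.
  have := Fc _ _ B0 Bx; move: Bx; rewrite closed_ballE// /closed_ball_ /= distrC.
  by move=> Bx Fx; rewrite (le_trans (ler_normB _ _))//; lra.
pose f : {fun (closed_ball x0 s) >-> (closed_ball x0 s)} :=
  HB.pack T (isFun.Build _ _ _ _ T TB).
have fc : is_contraction f.
  exists (2^-1)%:nng; split; first by rewrite /= invf_lt1 ?ltr1n.
  by move=> [x y] [/= Bx By]; exact: Tdist.
have [x Bx /= xE] := banach_fixed_point fc (@closed_ball_closed _ _ _ _) (ex_intro _ _ B0).
exists x => //; have {}xE : x = z - (F x - x) by exact: xE.
by apply/eqP; rewrite eq_sym -subr_eq0 -(subrK x (F x)) opprD addrA -xE subrr.
Qed.

End local_inverse.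

Section inverse_function_theorem.
Context {R : realType}.

Lemma diff_sub_id (V : normedModType R) (f : V -> V) (x : V) :
  differentiable f x ->
  differentiable (fun y => f y - y) x /\
  forall v, 'd (fun y => f y - y) x v = 'd f x v - v.
Proof.
move=> df; have d := is_diffB (differentiableP df) (is_diff_id x).
split; first exact: (ex_diff (is_diff_def := d)).
by move=> v; exact: (congr1 (@^~ v) (diff_val (is_diff_def := d))).
Qed.

Lemma norm_le_double (V : normedModType R) (v w : V) :
  `|w - v| <= 2^-1 * `|v| -> `|v| <= 2 * `|w|.
Proof.
have := ler_normD (v - w) w; rewrite subrK distrC => H1 H2; lra.
Qed.

Lemma near_norm_le (V : normedModType R) (x : V) e :
  0 < e -> \forall y \near x, `|y - x| <= e.
Proof.
move=> e0; have /cvgrPdist_le /(_ _ e0) := @cvg_id _ (nbhs x).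
by apply: filterS => y; rewrite distrC.
Qed.

Lemma lipschitz_continuous (V W : normedModType R) (O : set V) (f : V -> W) c :
  0 < c -> open O ->
  (forall x y, O x -> O y -> `|f x - f y| <= c * `|x - y|) ->
  forall x, O x -> {for x, continuous f}.
Proof.
move=> c0 oO fc x Ox; apply/cvgrPdist_le => e e0; near=> y.
have Oy : O y by near: y; exact: open_nbhs_nbhs.
rewrite (le_trans (fc _ _ Ox Oy))// -ler_pdivlMl// distrC.
by near: y; apply: near_norm_le; rewrite mulr_gt0// invr_gt0.
Unshelve. all: by end_near. Qed.

(** One estimate on a ball, |dF v - v| <= |v| / 2, drives everything: F - id is a contraction, so F
    is open; F shrinks distances by at most a factor 2, so it is injective with 2-Lipschitz inverse;
    and each dF is invertible with inverse bounded by 2. *)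
Theorem local_inverse_tangent_id n (U : set 'rV[R]_n) (F : 'rV[R]_n -> 'rV[R]_n)
    (y0 : 'rV[R]_n) :
  open U -> U y0 -> smooth U F -> (forall v, 'd F y0 v = v) ->
  exists (B : set 'rV[R]_n) (Fi : 'rV[R]_n -> 'rV[R]_n),
    [/\ open B, B y0, B `<=` U, open (F @` B) &
        (forall x, B x -> Fi (F x) = x) /\ smooth (F @` B) Fi].
Proof.
move=> oU Uy0 CF dF0.
have /nbhs_ballP[r /= r0 rP] : \forall x \near y0,
    U x /\ forall v, `|'d F x v - v| <= 2^-1 * `|v|.
  apply: filterI; first exact: open_nbhs_nbhs.
  exact: near_diff_tangent_id oU Uy0 (CF 1) dF0.
pose B := ball y0 r.
have oB : open B by exact: ball_open.
have BU : B `<=` U by move=> x /rP[].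
have dF x : B x -> differentiable F x by move=> /BU; exact: (CF 1).1.
have dFB x v : B x -> `|'d F x v - v| <= 2^-1 * `|v| by move=> /rP[_]; exact.
have Fc x y : B x -> B y -> `|(F y - y) - (F x - x)| <= 2^-1 * `|y - x|.
  apply: (@mean_value_ball _ _ _ (fun y => F y - y) y0 r).
    by move=> z /dF/diff_sub_id[].
  by move=> z v Bz; rewrite (diff_sub_id (dF z Bz)).2; exact: dFB.
have F_expand x y : B x -> B y -> `|y - x| <= 2 * `|F y - F x|.
  move=> Bx By; apply: norm_le_double.
  have -> : F y - F x - (y - x) = F y - y - (F x - x).
    by rewrite !opprB addrACA [RHS]addrACA [- F x + _]addrC.
  exact: Fc.
(* The default [y0] is taken only outside the image of [B]. *)
pose Fi z := xget y0 [set x | B x /\ F x = z].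
have FiP z : (F @` B) z -> B (Fi z) /\ F (Fi z) = z.
  by move=> [x Bx Fx]; apply: (@xgetPex _ y0 [set x | B x /\ F x = z]); exists x.
have FK x : B x -> Fi (F x) = x.
  move=> Bx; have [BFi FFi] := FiP (F x) (imageP F Bx).
  apply/eqP; rewrite -subr_eq0 -normr_le0 (le_trans (F_expand _ _ Bx BFi))//.
  by rewrite FFi subrr normr0 mulr0.
have oFB : open (F @` B).
  rewrite openE => _ [x Bx <-].
  have /nbhs_ballP[s /= s0 sB] : nbhs x B by exact: open_nbhs_nbhs.
  (* The fixed point argument needs a closed ball inside the open set [B]. *)
  have s20 : 0 < s / 2 by rewrite divr_gt0.
  have csB : closed_ball x (s / 2) `<=` B.
    apply: subset_trans sB; apply: closed_ball_subset => //.
    by rewrite ltr_pdivrMr// ltr_pMr// ltr1n.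
  have : \forall z \near F x, `|z - F x| <= 2^-1 * (s / 2).
    by apply: near_norm_le; rewrite mulr_gt0.
  apply: filterS => z zs.
  have [y By <-] := contraction_solve s20
    (fun y y' By By' => Fc y y' (csB _ By) (csB _ By')) zs.
  by exists y => //; exact: csB.
have Fi_continuous z : (F @` B) z -> {for z, continuous Fi}.
  apply: (@lipschitz_continuous _ _ _ _ 2) oFB _ z => // z1 z2 Oz1 Oz2.
  have [Bz1 Fz1] := FiP z1 Oz1; have [Bz2 Fz2] := FiP z2 Oz2.
  by rewrite -[in leRHS]Fz1 -[in leRHS]Fz2; exact: F_expand.
exists B, Fi; split => //; first exact: ballxx.
split=> //.
have dFK x : B x -> cancel ('d F x) (fun w => w *m invmx (lin1_mx ('d F x))) /\
    cancel (fun w => w *m invmx (lin1_mx ('d F x))) ('d F x).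
  move=> Bx; apply: injective_linear_row; first exact: linearP.
  move=> v dFv; have := norm_le_double (dFB x v Bx).
  by rewrite dFv normr0 mulr0 normr_le0 => /eqP.
apply: (@smooth_inverse _ _ _ B _ F Fi
  (fun z => z.2 *m invmx (lin1_mx ('d F (z.1 : 'rV[R]_n)))) 2) => //.
- by move=> k; apply: Ck_subset (CF k).
- by move=> x /dFK[].
- by move=> x /dFK[].
move=> x w Bx /=; have {2}<- := (dFK x Bx).2 w.
exact: norm_le_double (dFB x _ Bx).
Qed.

End inverse_function_theorem.

(** * Observables on the parameter manifold *)

Section observables.
Context {R : realType} {m : nat} {S : manifold R m}.

Lemma chart_img_setI (i : chart_ix S) (U : set S) :
  chart i @` (chart_dom i `&` U) = chart_img i `&` chart_inv i @^-1` U.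
Proof.
apply/seteqP; split=> [_ [x [ix Ux] <-]|_ [[x ix <-]]] /=.
  by split; [exists x|rewrite /= chartK].
by rewrite chartK// => Ux; exists x.
Qed.

Lemma open_chart_img_setI (i : chart_ix S) (U : set S) :
  open U -> open (chart i @` (chart_dom i `&` U)).
Proof.
move=> oU; rewrite chart_img_setI; apply: open_setI_preimage => //.
  exact: chart_img_open.
exact: chart_inv_continuous.
Qed.

Context {XX : normedModType R}.

Lemma smooth_joint_observable (a0 : XX) (A : S -> XX) (E : postprocessing_class a0)
    (psi : 'I_m -> E) (U : set S) :
  open U -> smooth_to U A -> A @` U `<=` pp_dom E ->
  smooth_to U (joint_observable A psi).
Proof.
move=> oU CA AU i k; have oiU := open_chart_img_setI (i := i) oU.
apply: (Ck_row (f := fun r => pp_eval (psi r) \o (A \o chart_inv i)) oiU) => r.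
apply: (Ck_comp oiU (@pp_dom_open _ _ _ E) _ (CA i k) (pp_eval_smooth (psi r) k)).
by move=> _ [x [ix Ux] <-] /=; rewrite chartK//; apply: AU; exists x.
Qed.

Lemma mdiff_linear (A : S -> XX) (p : S) : linear (mdiff A p).
Proof. exact: linearP. Qed.

(* The [r]-th observation extends the [r]-th coordinate of the inverse of [L]. *)
Lemma dual_postprocessings (a0 : XX) (L : 'rV[R]_m -> XX) (E : postprocessing_class a0) :
  linear L -> injective L -> scalar_richness L E ->
  exists psi : 'I_m -> E, forall v r, rho (psi r) (L v) = v 0 r.
Proof.
move=> lL iL /sr_rho_surjective surj.
(* [Li] is 0 off the range of [L], so in general not linear on [XX]; richness asks for linearity on
   the range only. *)
pose Li w := xget 0 [set v | L v = w].
have LK v : Li (L v) = v.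
  by apply: iL; apply: (@xgetPex _ 0 [set u | L u = L v]); exists v.
have /choice[psi psiP] (r : 'I_m) : exists psi : E, forall v, rho psi (L v) = v 0 r.
  have [|psi psiP] := surj (fun w => Li w 0 r : R^o).
    by move=> b _ _ [v _ <-] [v' _ <-]; rewrite -lL !LK !mxE.
  by exists psi => v; rewrite psiP ?LK//; exists v.
by exists psi => v r.
Qed.

Lemma diff_joint_observable (A : S -> XX) (p0 : S) (E : postprocessing_class (A p0))
    (psi : 'I_m -> E) :
  smooth_to [set: S] A -> (forall v r, rho (psi r) (mdiff A p0 v) = v 0 r) ->
  differentiable (joint_observable A psi \o chart_inv (chart_at p0))
    (chart (chart_at p0) p0) ->
  forall v, mdiff (joint_observable A psi) p0 v = v.
Proof.
move=> CA psiP dF v; apply/rowP => r; rewrite -(psiP v); set i0 := chart_at p0 in dF *.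
have dom0 : chart_dom i0 p0 by exact: chart_atP.
have dcoord u : is_diff u (fun u : 'rV[R]_m => u 0 r : R^o) (fun u => u 0 r).
  by apply: is_diff_linear; [move=> a w w'; rewrite !mxE|exact: coord_continuous].
have dFr := is_diff_comp (differentiableP dF) (dcoord _).
have dA : differentiable (A \o chart_inv i0) (chart i0 p0).
  by apply: (CA i0 1).1; exists p0.
have dE : differentiable (pp_eval (psi r)) ((A \o chart_inv i0) (chart i0 p0)).
  by rewrite /= chartK//; apply: (pp_eval_smooth (psi r) 1).1; exact: pp_dom_a0.
have dEA := is_diff_comp (differentiableP dA) (differentiableP dE).
(* The same scalar function is differentiated twice: as a coordinate of the observable, and by the
   chain rule through [A], where [rho] appears. *)
have eqF : (fun u : 'rV[R]_m => u 0 r) \o (joint_observable A psi \o chart_inv i0)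
    = pp_eval (psi r) \o (A \o chart_inv i0).
  by apply/funext => y /=; rewrite mxE.
have := congr1 (@^~ v) (diff_val (is_diff_def := dFr)).
by rewrite eqF (diff_val (is_diff_def := dEA)) /= chartK//.
Qed.

Theorem local_diffeo_observable (A : S -> XX) (p0 : S)
    (E : postprocessing_class (A p0)) :
  smooth_to [set: S] A -> injective (mdiff A p0) ->
  scalar_richness (mdiff A p0) E ->
  exists psi : 'I_m -> E, let F := joint_observable A psi in
    [/\ differentiable (F \o chart_inv (chart_at p0)) (chart (chart_at p0) p0),
        bijective (mdiff F p0) &
        exists U : set S, [/\ open U, U p0, A @` U `<=` pp_dom E &
          local_diffeo_onto_open U F]].
Proof.
move=> CA iA richE; have [psi psiP] := dual_postprocessings (mdiff_linear A p0) iA richE.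
exists psi => F; set i0 := chart_at p0 in psiP *; set y0 := chart i0 p0.
have dom0 : chart_dom i0 p0 by exact: chart_atP.
(* Postprocessings are controlled only on [pp_dom E], so the chart is first cut down to the points
   that [A] sends there. *)
pose O := chart_img i0 `&` (A \o chart_inv i0) @^-1` pp_dom E.
have chartT i : chart i @` (chart_dom i `&` [set: S]) = chart_img i.
  by rewrite setIT.
have oO : open O.
  apply: open_setI_preimage; [exact: chart_img_open| |exact: pp_dom_open].
  by move=> x ix; apply: (CA i0 0); rewrite chartT.
have Oy0 : O y0 by split; [exists p0|rewrite /= chartK//; exact: pp_dom_a0].
have CF : smooth O (F \o chart_inv i0).
  move=> k; apply: (Ck_row (f := fun r => pp_eval (psi r) \o (A \o chart_inv i0)) oO) => r.
  apply: (Ck_comp oO (@pp_dom_open _ _ _ E) _ _ (pp_eval_smooth (psi r) k)).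
    by move=> x [].
  by apply: Ck_subset (CA i0 k); rewrite chartT => x [].
have dF0 := (CF 1).1 y0 Oy0; have mF := diff_joint_observable CA psiP dF0.
have [B [Fi [oB By0 BO oFB [FiK CFi]]]] := local_inverse_tangent_id oO Oy0 CF mF.
split=> //; first by exists id => v; rewrite mF.
pose U := chart_dom i0 `&` chart i0 @^-1` B.
have oU : open U.
  apply: open_setI_preimage => //; first exact: chart_dom_open.
  exact: chart_continuous.
have AU : A @` U `<=` pp_dom E.
  by move=> _ [x [ix Bx] <-]; have [_] := BO _ Bx; rewrite /= chartK.
have FU : F @` U = (F \o chart_inv i0) @` B.
  apply/seteqP; split=> [_ [x [ix Bx] <-]|_ [y By <-]].
    by exists (chart i0 x) => //=; rewrite chartK.
  have [[x ix xy] _] := BO y By; exists x; first by split => //=; rewrite xy.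
  by rewrite /= -xy chartK.
exists U; split=> //; split.
- apply: smooth_joint_observable => // i k.
  by apply: Ck_subset (CA i k) => _ [x [ix _] <-]; exists x.
- by rewrite FU.
exists (chart_inv i0 \o Fi); split.
  move=> p [ip Bp] /=; have := FiK _ Bp; rewrite /= chartK// => ->.
  by rewrite chartK.
have FiB z : (F @` U) z -> B (Fi z) by rewrite FU => -[y By <-]; rewrite FiK.
have cinv z : (F @` U) z -> {for z, continuous (chart_inv i0 \o Fi)}.
  move=> Uz; apply: continuous_comp; first by apply: (CFi 0); rewrite -FU.
  by apply: chart_inv_continuous; case: (BO _ (FiB _ Uz)).
split=> // i k.
(* In another chart [i], the inverse is [Fi] followed by the transition map from [i0] to [i]. *)
apply: (@Ck_comp _ _ _ _ _ _ (chart i0 @` (chart_dom i0 `&` chart_dom i)) Fi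
  (chart i \o chart_inv i0)) (chart_transition i0 i k).
- by apply: open_setI_preimage => //; [rewrite FU|exact: chart_dom_open].
- by apply: open_chart_img_setI; exact: chart_dom_open.
- by move=> z [Uz iz]; rewrite chart_img_setI; split => //; case: (BO _ (FiB _ Uz)).
- by apply: Ck_subset (CFi k); rewrite -FU => z [].
Qed.

End observables.

Theorem theorem6p5 (R : realType) (n d l m : nat)
  (M : manifold R n) (N : manifold R d) (K : lie_group R l)
  (aM : smooth_action K M) (aN : smooth_action K N)
  (M_compact : compact [set: M]) (N_compact : compact [set: N])
  (M_coh1 : cohomogeneity_one aM)
  (lambda : R) (lambda_gt0 : 0 < lambda)
  (I : set R) (I_open : open I) (I_itv : is_interval I) (I_neq0 : I !=set0)
  (gamma : R -> M) (gamma_smooth : smooth_curve I gamma)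
  (S : manifold R m) (p0 : S) (g : S -> metric_field M)
  (g_einstein : normalized_einstein_family aM lambda I gamma g)
  (h : metric_field N) (h_riem : riemannian h) (h_inv : invariant_metric aN h)
  (k : nat) (k_ge4 : (4 <= k)%N) (alpha : R) (alpha_gt0 : 0 < alpha) (alpha_lt1 : alpha < 1)
  (C : probe_conditions M N) (B : ball_cover M) (j : 'I_(bc_size B) -> chart_ix N)
  (f0 : M -> N) (f : S -> M -> N)
  (f_branch : harmonic_branch aM aN h k alpha C j g p0 f0 f)
  (X Y : completeNormedModType R)
  (PhiX : forall p : S, X -> field_along (f p))
  (PhiY : forall p : S, Y -> field_along (f p))
  (J : S -> blin X Y) (G : S -> blin Y X)
  (JG_package : jacobi_package aM aN h k alpha C j g PhiX PhiY J G)
  (A_smooth : smooth_to [set: S] (core_package J G))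
  (response_inj : injective (universal_response J G p0))
  (E : postprocessing_class (core_package J G p0))
  (E_rich : scalar_richness (universal_response J G p0) E) :
  exists psi : 'I_m -> E,
    let A := core_package J G in
    let F := joint_observable A psi in
    [/\ differentiable (F \o chart_inv (chart_at p0)) (chart (chart_at p0) p0)
          /\ bijective (mdiff F p0),
        exists U : set S,
          [/\ open U, U p0, A @` U `<=` pp_dom E, local_diffeo_onto_open U F &
              forall p q, U p -> U q ->
                (forall r, pp_eval (psi r) (A p) = pp_eval (psi r) (A q)) -> p = q] &
        locally_injective g ->
        exists U : set S,
          [/\ open U, U p0, A @` U `<=` pp_dom E &
              forall p q, U p -> U q ->
                (forall r, pp_eval (psi r) (A p) = pp_eval (psi r) (A q))
                <-> g p = g q]].
Proof.
have [psi [dF bF [U [oU Up0 AU ldU]]]] :=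
  local_diffeo_observable A_smooth response_inj E_rich.
have Uinj p q : U p -> U q -> (forall r, pp_eval (psi r) (core_package J G p) =
    pp_eval (psi r) (core_package J G q)) -> p = q.
  move=> Up Uq pq; have [Fi [FK _]] := ld_inv ldU.
  rewrite -(FK p Up) -(FK q Uq); congr Fi.
  by apply/rowP => r; rewrite !mxE.
exists psi => A F; split=> //; first by exists U.
move=> /(_ p0)[U' [oU' U'p0] ginj].
exists (U `&` U'); split=> //; first exact: openI.
  by move=> _ [x [Ux _] <-]; apply: AU; exists x.
(* Equal observations force p = q, hence equal metrics. Local injectivity enters in the converse:
   equal metrics have equal parameters, so the observations depend on the metric alone. *)
move=> p q [Up U'p] [Uq U'q]; split; first by move=> /(Uinj _ _ Up Uq) ->.
by move=> /(ginj _ _ U'p U'q) ->.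
Qed.
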